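(* Let $T$ be a complete theory. If $\varphi(x,y)$ witnesses SOP$_1$, then there exists a $\beta$-indiscernible tree $\langle e_\eta\rangle_{\eta\in{}^{\omega>}2}$ (in a monster model of $T$) which witnesses SOP$_1$ with $\varphi$.
   Context: ${}^{\omega>}2$ is the binary tree of finite $0/1$-sequences with initial-segment order $\trianglelefteq$, meet $\wedge$ and concatenation $^\frown$. $\varphi(x,y)$ witnesses SOP$_1$ with $\langle a_\eta\rangle_{\eta\in{}^{\omega>}2}$ if (i) for all $\eta\in{}^\omega2$, $\{\varphi(x,a_{\eta\lceil n}):n<\omega\}$ is consistent, and (ii) for all $\eta,\nu\in{}^{\omega>}2$, $\{\varphi(x,a_{\eta^\frown\langle1\rangle}),\varphi(x,a_{\eta^\frown\langle0\rangle^\frown\nu})\}$ is inconsistent. For tuples $\bar\eta=\langle\eta_0,\dots,\eta_n\rangle$, $\bar\nu=\langle\nu_0,\dots,\nu_n\rangle$ in ${}^{\omega>}2$, $\bar\eta\approx_\beta\bar\nu$ means: (i) the sets of entries of $\bar\eta$ and of $\bar\nu$ are closed under $\wedge$; (ii) $\eta_i\trianglelefteq\eta_j\iff\nu_i\trianglelefteq\nu_j$; (iii) $\eta_i^\frown\langle d\rangle\trianglelefteq\eta_j\iff\nu_i^\frown\langle d\rangle\trianglelefteq\nu_j$ for $d\le1$; (iv) $\eta_i^\frown\langle1\rangle=\eta_j\iff\nu_i^\frown\langle1\rangle=\nu_j$ — for all $i,j\le n$. A tree $\langle e_\eta\rangle$ is $\beta$-indiscernible if $\bar\eta\approx_\beta\bar\nu$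 implies $\langle e_{\eta_0},\dots,e_{\eta_n}\rangle\equiv\langle e_{\nu_0},\dots,e_{\nu_n}\rangle$. *)

(* Defs.v *)
From mathcomp Require Import all_boot.
From Stdlib Require List.
Set Implicit Arguments.
Unset Strict Implicit.
Unset Printing Implicit Defensive.

Record language := Language {
  Fun : Type;  Rel : Type;
  farity : Fun -> nat;  rarity : Rel -> nat }.

Inductive term (L : language) (V : Type) : Type :=
| Var : V -> term L V
| App : forall f : Fun L, ('I_(farity f) -> term L V) -> term L V.

(* Formulas with free variables among V (well-scoped de Bruijn style:
   the existential quantifier binds the extra variable None). *)
Inductive formula (L : language) : Type -> Type :=
| Fal : forall V, formula L V
| Eqf : forall V, term L V -> term L V -> formula L V
| Rlf : forall V (r : Rel L), ('I_(rarity r) -> term L V) -> formula L V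
| Neg : forall V, formula L V -> formula L V
| Conj : forall V, formula L V -> formula L V -> formula L V
| Exf : forall V, formula L (option V) -> formula L V.

Record structure (L : language) := Structure {
  dom :> Type;
  inhab : dom;
  funI : forall f : Fun L, ('I_(farity f) -> dom) -> dom;
  relI : forall r : Rel L, ('I_(rarity r) -> dom) -> Prop }.

Fixpoint eval (L : language) (M : structure L) (V : Type) (rho : V -> M)
  (t : term L V) : M :=
  match t with
  | Var v => rho v
  | App f args => @funI L M f (fun i => eval rho (args i))
  end.

Definition ext (M : Type) (V : Type) (rho : V -> M) (a : M) : option V -> M :=
  fun o => match o with Some v => rho v | None => a end.

Fixpoint sat (L : language) (M : structure L) (V : Type) (phi : formula L V)
  : (V -> M) -> Prop :=
  match phi in formula _ V' return (V' -> M) -> Prop with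
  | Fal _ => fun _ => False
  | Eqf _ t u => fun rho => eval rho t = eval rho u
  | Rlf _ r args => fun rho => @relI L M r (fun i => eval rho (args i))
  | Neg _ p => fun rho => ~ @sat L M _ p rho
  | Conj _ p q => fun rho => @sat L M _ p rho /\ @sat L M _ q rho
  | Exf _ p => fun rho => exists a : M, @sat L M _ p (ext rho a)
  end.

Arguments sat {L} M {V} phi rho.

(* Elementary equivalence: N is a model of the complete theory Th(M). *)
Definition elem_equiv (L : language) (M N : structure L) : Prop :=
  forall psi : formula L void,
    @sat L M _ psi (fun v => match v with end) <-> @sat L N _ psi (fun v => match v with end).

Definition same_type (L : language) (M : structure L) (n m : nat)
  (a b : 'I_n -> 'I_m -> M) : Prop :=
  forall psi : formula L ('I_n * 'I_m),
    @sat L M _ psi (fun p => a p.1 p.2) <-> @sat L M _ psi (fun p => b p.1 p.2).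

Definition join (M : Type) (k m : nat) (x : 'I_k -> M) (y : 'I_m -> M)
  : 'I_k + 'I_m -> M :=
  fun v => match v with inl i => x i | inr j => y j end.

(* The partial type {phi(x,b) : b in A} (parameters in M) is consistent,
   i.e. finitely satisfiable in M. *)
Definition consistent (L : language) (M : structure L) (k m : nat)
  (phi : formula L ('I_k + 'I_m)) (A : ('I_m -> M) -> Prop) : Prop :=
  forall s : seq ('I_m -> M), (forall b, List.In b s -> A b) ->
    exists x : 'I_k -> M, forall b, List.In b s -> @sat L M _ phi (join x b).

Fixpoint tmeet (s t : seq bool) : seq bool :=
  match s, t with
  | a :: s', b :: t' => if a == b then a :: tmeet s' t' else [::]
  | _, _ => [::]
  end.

Definition restr (eta : nat -> bool) (n : nat) : seq bool := mkseq eta n.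


Arguments consistent {L} M {k m} phi A.

Definition witnesses_SOP1 (L : language) (M : structure L) (k m : nat)
  (phi : formula L ('I_k + 'I_m)) (a : seq bool -> 'I_m -> M) : Prop :=
  (forall eta : nat -> bool,
      consistent M phi (fun b => exists n, b = a (restr eta n))) /\
  (forall eta nu : seq bool,
      ~ consistent M phi (fun b => b = a (rcons eta true) \/
                                   b = a (rcons eta false ++ nu))).

Definition approx_beta (n : nat) (eta nu : 'I_n -> seq bool) : Prop :=
  (forall i j, exists l, eta l = tmeet (eta i) (eta j)) /\
  (forall i j, exists l, nu l = tmeet (nu i) (nu j)) /\
  (forall i j, prefix (eta i) (eta j) = prefix (nu i) (nu j)) /\
  (forall i j (d : bool),
      prefix (rcons (eta i) d) (eta j) = prefix (rcons (nu i) d) (nu j)) /\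
  (forall i j, (rcons (eta i) true == eta j) = (rcons (nu i) true == nu j)).

Arguments same_type {L} M {n m} a b.

Definition beta_indiscernible (L : language) (M : structure L) (m : nat)
  (e : seq bool -> 'I_m -> M) : Prop :=
  forall n (eta nu : 'I_n.+1 -> seq bool), approx_beta eta nu ->
    same_type M (fun i => e (eta i)) (fun i => e (nu i)).
Arguments witnesses_SOP1 {L} M {k m} phi a.
Arguments beta_indiscernible {L} M {m} e.

(* Main.v *)
(* Call two meet-closed tuples of nodes alpha-equivalent if they agree on the
   relations [prefix s t] and [prefix (rcons s d) t].

   In the compact semigroup of ultrafilters on finite 0/1-sequences there are
   [U 0], [U 1] such that [0 :: U 0] and [1 :: U 1] are idempotents of the same
   minimal left ideal, hence [U b * (c :: U c) = U b] for all [b], [c]. Choosing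
   the images of the nodes of a finite tree generically, in depth-first order,
   an image of [rcons s d] being [f s ++ d :: w] with [w] following [U d], gives
   an iterated limit of embeddings of the tree into itself. A node that is
   dropped from a meet-closed tuple is absorbed by the equation above, so the
   limit behaviour of a tuple depends on its alpha-equivalence class only. The
   ultrapower of [M] along a limit [W] of these ultrafilters therefore contains
   an alpha-indiscernible copy of any tree of parameters of [M].

   Apply this to the tree [s |-> a (rcons s true)], and then pull it back along
   [spread], the monoid morphism with [1 |-> 1] and [0 |-> 10]. A beta-type of a
   tuple determines the alpha-type of its image enlarged by the right
   successors, and [spread] sends branches to chains turning right and
   [rcons r true], [rcons r false ++ t] to a node and a node on its left, which
   is what the two clauses of SOP1 for [a] require. *)
Require Import Defs.
From mathcomp Require Import all_boot.
From mathcomp Require Import boolp classical_sets filter.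
Set Implicit Arguments.
Unset Strict Implicit.
Unset Printing Implicit Defensive.
Local Open Scope classical_set_scope.

(** * Ultrafilters *)

Lemma ultra_setC (T : Type) (U : set_system T) (A : set T) :
  UltraFilter U -> U (~` A) <-> ~ U A.
Proof.
move=> UU; split=> [UnA UA|nUA].
  by apply: (filter_not_empty U); rewrite -(setICr A); apply: filterI.
by have [] := in_ultra_setVsetC A UU.
Qed.

Lemma ultra_setCW (T : Type) (F : set_system T) : ProperFilter F ->
  (forall A, F A \/ F (~` A)) -> UltraFilter F.
Proof.
move=> FF FV; split=> // G GG FG; apply/seteqP; split=> // A GA.
have [//|/FG GnA] := FV A.
by case: (filter_not_empty G); rewrite -(setICr A); apply: filterI.
Qed.

Lemma ultra_subset_eq (T : Type) (U V : set_system T) :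
  UltraFilter U -> UltraFilter V -> U `<=` V -> U = V.
Proof. by move=> UU UV UsV; rewrite (max_filter _ UsV). Qed.

Lemma ultra_const (T : Type) (U : set_system T) (P : Prop) :
  UltraFilter U -> U (fun=> P) <-> P.
Proof.
move=> UU; split=> [/filter_const //|p].
by apply: filterS (filterT : U setT).
Qed.

Lemma ultra_bind (T V : Type) (p : set_system T) (q : T -> set_system V) :
  UltraFilter p -> (forall x, UltraFilter (q x)) ->
  UltraFilter [set A | p [set x | q x A]].
Proof.
move=> pU qU; apply: ultra_setCW.
  split; first by move=> /(@filter_ex _ p) [x]; apply: filter_not_empty.
  split=> [|A B pA pB|A B AB pA].
  - by apply: (@filterS _ p _ setT) => [x _|]; apply: filterT.
  - by apply: (@filterS2 _ p _ _ _ _ _ pA pB) => x; apply: filterI.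
  - by apply: (@filterS _ p _ _ _ _ pA) => x /=; apply: filterS => t; apply: AB.
move=> A; have [|H] := in_ultra_setVsetC [set x | q x A] pU; [by left|right].
by apply: filterS H => x /= nq; apply/ultra_setC.
Qed.

Lemma ultra_preimage (T V : Type) (f : T -> V) (q : set_system T) :
  UltraFilter q -> UltraFilter [set A | q (f @^-1` A)].
Proof.
move=> qU; have := ultra_bind qU (fun x => principal_filter_ultra (f x)).
congr UltraFilter; apply/funext => A; congr (q _).
by apply/funext => x; apply/propext; apply: principal_filterP.
Qed.

(** * Compactness of the space of ultrafilters *)

Section UltrafilterSpace.
Variable T : Type.
Implicit Types (E C D : set (set_system T)) (p q r : set_system T).

(** Closedness in the Stone topology, with basic clopen sets [[set p | p A]]: a point of the closure
    contains every [A] common to all members of [E]. *)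
Definition ultra_closed E : Prop :=
  E `<=` @UltraFilter T /\
  forall p, UltraFilter p -> (forall A, (forall q, E q -> q A) -> p A) -> E p.

Lemma ultra_closedT : ultra_closed (@UltraFilter T).
Proof. by split. Qed.

Lemma ultra_closed_bigcap (F : set (set (set_system T))) :
  F !=set0 -> F `<=` ultra_closed -> ultra_closed (\bigcap_(C in F) C).
Proof.
move=> [C0 FC0] Fcl; split=> [p /(_ _ FC0)|p pU pF C FC].
  by have [sU _] := Fcl _ FC0; apply: sU.
have [_ cl] := Fcl _ FC; apply: cl => // A CA; apply: pF => q /(_ _ FC).
exact: CA.
Qed.

(** Compactness: the sets common to all members of some [C] in the chain form a proper filter, and
    an ultrafilter extending it lies in every [C]. *)
Lemma chain_bigcap_nonempty (F : set (set (set_system T))) :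
  F `<=` ultra_closed -> F `<=` (fun C => C !=set0) ->
  F !=set0 -> (forall C D, F C -> F D -> C `<=` D \/ D `<=` C) ->
  \bigcap_(C in F) C !=set0.
Proof.
move=> Fcl Fn0 [C0 FC0] Ftot.
pose G : set_system T := [set A | exists2 C, F C & forall q, C q -> q A].
have Gpf : ProperFilter G.
  split=> [[C FC C0']|].
    have [q Cq] := Fn0 _ FC; have [/(_ _ Cq) qU _] := Fcl _ FC.
    by apply: (filter_not_empty q); apply: C0'.
  split=> [|A B [C FC CA] [D FD DB]|A B AB [C FC CA]].
  - exists C0 => // q C0q; have [/(_ _ C0q) qU _] := Fcl _ FC0.
    exact: filterT.
  - have [CD|DC] := Ftot _ _ FC FD.
      exists C => // q Cq; have [/(_ _ Cq) qU _] := Fcl _ FC.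
      exact: filterI (CA _ Cq) (DB _ (CD _ Cq)).
    exists D => // q Dq; have [/(_ _ Dq) qU _] := Fcl _ FD.
    exact: filterI (CA _ (DC _ Dq)) (DB _ Dq).
  - exists C => // q Cq; have [/(_ _ Cq) qU _] := Fcl _ FC.
    exact: filterS AB (CA _ Cq).
have [p [pU Gp]] := ultraFilterLemma Gpf.
exists p => C FC; have [_ cl] := Fcl _ FC; apply: cl => // A CA.
by apply: Gp; exists C.
Qed.

(** Zorn's lemma for reverse inclusion, to be used for closed subsemigroups and for closed left
    ideals. Compactness provides the non-empty intersections. *)
Lemma minimal_ultra_closed (P : set (set (set_system T))) C0 :
  P `<=` ultra_closed -> P `<=` (fun C => C !=set0) ->
  (forall F, F !=set0 -> F `<=` P -> \bigcap_(C in F) C !=set0 ->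
     P (\bigcap_(C in F) C)) ->
  P C0 -> exists2 C, P C & forall D, P D -> D `<=` C -> C `<=` D.
Proof.
move=> Pcl Pn0 Pcap PC0.
pose R (C D : {C | P C}) := `[< sval D `<=` sval C >].
have [||A Atot|[C PC] Cmin] := @ZL_preorder _ (exist _ C0 PC0) R.
- by move=> C; apply/asboolP.
- by move=> C D E /asboolP CD /asboolP DE; apply/asboolP; apply: subset_trans DE CD.
- have [[C1 AC1]|An0] := pselect (A !=set0); last first.
    by exists (exist _ C0 PC0) => C AC; case: An0; exists C.
  pose F := [set sval C | C in A].
  have Fn0 : F !=set0 by exists (sval C1), C1.
  have FP : F `<=` P by move=> _ [C _ <-]; apply: (svalP C).
  have capP : P (\bigcap_(C in F) C).
    apply: Pcap => //; apply: chain_bigcap_nonempty => //.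
    + by move=> C /FP/Pcl.
    + by move=> C /FP/Pn0.
    + move=> _ _ [C AC <-] [D AD <-].
      by case: (Atot C D AC AD) => /asboolP; [right|left].
  exists (exist _ _ capP) => C AC; apply/asboolP => p /= /(_ (sval C)); apply.
  by exists C.
- exists C => // D PD DC.
  have /asboolP := Cmin (exist _ D PD) (introT (asboolP _) DC).
  exact.
Qed.

(* The image of a compact set under a continuous map, the map being given by
   its inverse image operation [g] on clopen sets. *)
Lemma ultra_closed_image (g : set T -> set T) E :
  (forall q, UltraFilter q -> UltraFilter [set A | q (g A)]) ->
  ultra_closed E -> ultra_closed [set [set A | q (g A)] | q in E].
Proof.
move=> gU [EU cl]; split=> [_ [q /EU qU <-]|r rU rE]; first exact: gU.
(* An ultrafilter extending [F] is a point of [E], and it contains [g A] for every [A] in [r]. *)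
pose F : set_system T :=
  [set X | exists2 A, r A & forall q, E q -> q (g A) -> q X].
have gE q : E q -> UltraFilter [set A | q (g A)] by move=> /EU/gU.
have Fpf : ProperFilter F.
  split=> [[A rA A0]|].
    have : r (~` A).
      apply: rE => _ [q Eq <-]; have qgU := gE _ Eq; have qU := EU _ Eq.
      apply/(@ultra_setC _ [set A | q (g A)]) => /(A0 _ Eq).
      exact: filter_not_empty.
    by move=> /ultra_setC.
  split=> [|X Y [A rA AX] [B rB BY]|X Y XY [A rA AX]].
  - exists setT; first exact: filterT.
    by move=> q /EU qU _; apply: filterT.
  - exists (A `&` B); first exact: filterI.
    move=> q Eq qAB; have qgU := gE _ Eq; have qU := EU _ Eq.
    have qgS X' Y' : X' `<=` Y' -> q (g X') -> q (g Y').
      exact: (@filterS _ [set A | q (g A)]).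
    apply: filterI; [apply: AX|apply: BY] => //.
      exact: qgS (@subIsetl _ _ _) qAB.
    exact: qgS (@subIsetr _ _ _) qAB.
  - exists A => // q Eq qA; have qU := EU _ Eq.
    exact: filterS XY (AX _ Eq qA).
have [q [qU Fq]] := ultraFilterLemma Fpf.
have Eq : E q.
  apply: cl => // A EA; apply: Fq; exists setT; first exact: filterT.
  by move=> q' Eq' _; apply: EA.
exists q => //; apply/esym/ultra_subset_eq => // A rA.
by apply: Fq; exists A.
Qed.

End UltrafilterSpace.

(** * Idempotents and minimal left ideals for convolution *)

Section Semigroup.
Variables (T : Type) (op : T -> T -> T).
Hypothesis opA : associative op.
Implicit Types (E C D : set (set_system T)) (p q r : set_system T).

Definition conv p q : set_system T := [set A | p [set s | q (op s @^-1` A)]].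

Lemma convA : associative conv.
Proof.
move=> p q r; apply/funext => A; rewrite /conv /=.
congr (p _); apply/funext => s /=; congr (q _); apply/funext => t /=.
by congr (r _); apply/funext => u /=; rewrite opA.
Qed.

Lemma conv_ultra p q : UltraFilter p -> UltraFilter q -> UltraFilter (conv p q).
Proof.
by move=> pU qU; apply: ultra_bind pU (fun s => ultra_preimage (op s) qU).
Qed.

(* The Ellis-Numakura lemma. *)
Lemma idempotent_ultra C : ultra_closed C -> C !=set0 ->
  (forall p q, C p -> C q -> C (conv p q)) -> exists2 p, C p & conv p p = p.
Proof.
move=> Ccl Cn0 Csg.
pose P := [set D | [/\ ultra_closed D, D !=set0, D `<=` C &
                      forall p q, D p -> D q -> D (conv p q)]].
have [||||E [Ecl [p Ep] EC Esg] Emin] := @minimal_ultra_closed _ P C.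
- by move=> D [].
- by move=> D [].
- move=> F [D0 FD0] FP capn0; split=> //.
  + by apply: ultra_closed_bigcap => [|D /FP []//]; exists D0.
  + by move=> p /(_ _ FD0); have [_ _ D0C _] := FP _ FD0; apply: D0C.
  + move=> p q capp capq D FD; have [_ _ _ Dsg] := FP _ FD.
    exact: Dsg (capp _ FD) (capq _ FD).
- by split.
have EU q : E q -> UltraFilter q by case: Ecl => EU _; apply: EU.
have pU := EU _ Ep.
(* By minimality [E * p] is all of [E], so [q * p = p] for some [q] in [E]. *)
have [||q Eq qp] := Emin [set conv q p | q in E] _ _ p Ep.
- split.
  + apply: (@ultra_closed_image _ (fun A => [set s | p (op s @^-1` A)])) => //.
    by move=> q qU; apply: conv_ultra.
  + by exists (conv p p), p.
  + by move=> _ [q Eq <-]; apply/EC/Esg.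
  + move=> _ _ [q Eq <-] [r Er <-]; exists (conv (conv q p) r).
      exact: Esg (Esg _ _ Eq Ep) Er.
    by rewrite !convA.
- by move=> _ [q Eq <-]; apply: Esg.
exists p; first exact: EC.
(* The solutions [q] of [q * p = p] form a closed subsemigroup of [E], hence all of [E]; so [p] is
   one of them. *)
have [||//] := Emin [set q | E q /\ conv q p = p] _ _ p Ep; last by move=> ? [].
split.
- split=> [r [/EU]//|r rU rH]; split.
    by case: Ecl => _; apply=> // A EA; apply: rH => s [/EA].
  apply/esym/ultra_subset_eq => //; first exact: conv_ultra.
  by move=> A pA; apply: rH => s [Es sp]; move: pA; rewrite -{1}sp.
- by exists q.
- by move=> r [/EC].
- move=> r s [Er rp] [Es sp]; split; first exact: Esg.
  by rewrite -convA sp.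
Qed.

(** For [p] in a minimal closed left ideal [C], the products [conv r p] form a closed left ideal
    inside [C], hence all of [C]. *)
Lemma minimal_left_ideal_ultra : (exists p, @UltraFilter T p) ->
  exists C, [/\ ultra_closed C, C !=set0,
    forall p q, UltraFilter p -> C q -> C (conv p q) &
    forall p q, C p -> C q -> exists2 r, UltraFilter r & conv r p = q].
Proof.
move=> Un0.
pose P := [set D | [/\ ultra_closed D, D !=set0 &
                      forall p q, UltraFilter p -> D q -> D (conv p q)]].
have [||||C [Ccl Cn0 Cid] Cmin] :=
  @minimal_ultra_closed _ P (@UltraFilter T).
- by move=> D [].
- by move=> D [].
- move=> F Fn0 FP capn0; split=> //.
    by apply: ultra_closed_bigcap => // D /FP [].
  move=> p q pU capq D FD; have [_ _ Did] := FP _ FD.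
  exact: Did (capq _ FD).
- by split=> [|//|p q]; [apply: ultra_closedT|apply: conv_ultra].
exists C; split=> // p q Cp Cq.
have [CU _] := Ccl; have pU := CU _ Cp.
have [||r rU rp] := Cmin [set conv r p | r in @UltraFilter T] _ _ q Cq.
- split.
  + apply: (@ultra_closed_image _ (fun A => [set s | p (op s @^-1` A)])) => //.
      by move=> r rU; apply: conv_ultra.
    exact: ultra_closedT.
  + by exists (conv p p), p.
  + move=> r _ rU [s sU <-]; exists (conv r s); first exact: conv_ultra.
    by rewrite convA.
- by move=> _ [r rU <-]; apply: Cid.
by exists r.
Qed.

End Semigroup.

(* Both [b :: U b] are idempotents in one minimal left ideal, so that
   [(b :: U b) * (c :: U c) = b :: U b]. *)
Lemma branching_ultrafilters :
  exists U : bool -> set_system (seq bool),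
    (forall b, UltraFilter (U b)) /\
    forall b c A, U b [set s | U c [set t | A (s ++ c :: t)]] <-> U b A.
Proof.
have catA' : associative (@cat bool) by move=> *; rewrite catA.
have [|C [Ccl [p0 Cp0] Cid Cmin]] := minimal_left_ideal_ultra catA'.
  by exists (principal_filter [::]); apply: principal_filter_ultra.
have CU p : C p -> UltraFilter p by case: Ccl => CU _; apply: CU.
pose shift b (q : set_system (seq bool)) : set_system (seq bool) :=
  [set A | q (cons b @^-1` A)].
have shiftE b q : shift b q = conv cat (principal_filter [:: b]) q.
  apply/funext => A; apply/propext; split.
    by move=> H; apply/principal_filterP.
  by move/principal_filterP.
have Cshift b q : C q -> C (shift b q).
  by move=> Cq; rewrite shiftE; apply: Cid => //; apply: principal_filter_ultra.
(* [b :: C] is a closed subsemigroup, since [(b :: q) * (b :: r) = b :: (q * (b :: r))]. *)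
have idem b : exists2 u, C u & conv cat (shift b u) (shift b u) = shift b u.
  have [|||_ [u Cu <-]] :=
    @idempotent_ultra _ _ catA' [set shift b q | q in C].
  - apply: (@ultra_closed_image _ (fun A => cons b @^-1` A)) => // q qU.
    exact: ultra_preimage.
  - by exists (shift b p0), p0.
  - move=> _ _ [q Cq <-] [r Cr <-]; exists (conv cat q (shift b r)) => //.
    exact: Cid (CU _ Cq) (Cshift _ _ Cr).
  - by exists u.
pose u b := projT1 (cid2 (idem b)).
have Cu b : C (u b) by rewrite /u; case: cid2.
have uu b : conv cat (shift b (u b)) (shift b (u b)) = shift b (u b).
  by rewrite /u; case: cid2.
(* By minimality [b :: u b] has the form [r * (c :: u c)], and the idempotent [c :: u c] is absorbed
   on the right. *)
have ubc b c : conv cat (shift b (u b)) (shift c (u c)) = shift b (u b).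
  have [r rU <-] := Cmin _ _ (Cshift c _ (Cu c)) (Cshift b _ (Cu b)).
  by rewrite -convA // uu.
exists u; split=> [b|b c A]; first exact/CU/Cu.
(* [behead] cancels the leading [b] on both sides. *)
have := congr1 (fun q => q [set s | A (behead s)]) (ubc b c).
by rewrite /conv /shift /preimage /= => ->.
Qed.

(** * Iterated limits of tree embeddings *)

Definition graft (x : seq bool) (f0 f1 : seq bool -> seq bool) (z : seq bool) :=
  match z with
  | [::] => x
  | false :: z' => f0 z'
  | true :: z' => f1 z'
  end.

(** These notions are relative to a set [J] of indices, so that an induction can pass to the entries
    on one side of the root without changing the index type. *)
Definition meet_closed (I : Type) (J : set I) (eta : I -> seq bool) :=
  forall i j, J i -> J j -> exists2 l, J l & eta l = tmeet (eta i) (eta j).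

Definition alpha_equiv (I : Type) (J : set I) (eta nu : I -> seq bool) :=
  [/\ meet_closed J eta, meet_closed J nu,
      forall i j, J i -> J j -> prefix (eta i) (eta j) = prefix (nu i) (nu j) &
      forall i j d, J i -> J j ->
        prefix (rcons (eta i) d) (eta j) = prefix (rcons (nu i) d) (nu j)].

Definition local_on (I : Type) (J : set I) (k : set (I -> seq bool)) :=
  forall f g, (forall j, J j -> f j = g j) -> k f = k g.

Lemma meet_closed_behead (I : Type) (J K : set I) (eta : I -> seq bool) c :
  meet_closed J eta -> K `<=` J ->
  (forall j, J j -> prefix [:: c] (eta j) <-> K j) ->
  meet_closed K (behead \o eta).
Proof.
move=> mc KJ Kc i j Ki Kj; have [l Jl El] := mc _ _ (KJ _ Ki) (KJ _ Kj).
have := Kc _ (KJ _ Ki); have := Kc _ (KJ _ Kj); have := Kc _ Jl.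
rewrite /= El; case: (eta i) El => [|a s]; first by move=> _ _ _ [_ /(_ Ki)].
case: (eta j) => [|b t]; first by move=> _ _ [_ /(_ Kj)].
move=> + + [_ /(_ Kj) /andP[/eqP Eb _]] [_ /(_ Ki) /andP[/eqP Ea _]].
rewrite -Ea -Eb /= eqxx /= ?eqxx ?prefix0s => El [/(_ isT) Kl _].
by exists l => //=; rewrite El.
Qed.

Lemma alpha_equiv_behead (I : Type) (J K : set I) (eta nu : I -> seq bool) b c :
  alpha_equiv J eta nu -> K `<=` J ->
  (forall j, J j -> prefix [:: b] (eta j) <-> K j) ->
  (forall j, J j -> prefix [:: c] (nu j) <-> K j) ->
  alpha_equiv K (behead \o eta) (behead \o nu).
Proof.
move=> [me mn pe de] KJ Kb Kc.
have Eb j : K j -> eta j = b :: behead (eta j).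
  move=> Kj; have := (Kb _ (KJ _ Kj)).2 Kj.
  by case: (eta j) => //= a s /andP[/eqP<-].
have Ec j : K j -> nu j = c :: behead (nu j).
  move=> Kj; have := (Kc _ (KJ _ Kj)).2 Kj.
  by case: (nu j) => //= a s /andP[/eqP<-].
split.
- exact: meet_closed_behead me KJ Kb.
- exact: meet_closed_behead mn KJ Kc.
- move=> i j Ki Kj; have := pe _ _ (KJ _ Ki) (KJ _ Kj).
  by rewrite (Eb i) // (Eb j) // (Ec i) // (Ec j) //= !eqxx.
- move=> i j d Ki Kj; have := de _ _ d (KJ _ Ki) (KJ _ Kj).
  by rewrite (Eb i) // (Eb j) // (Ec i) // (Ec j) //= !eqxx.
Qed.

Lemma alpha_equiv_sym (I : Type) (J : set I) (eta nu : I -> seq bool) :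
  alpha_equiv J eta nu -> alpha_equiv J nu eta.
Proof. by move=> [? ? pe de]; split=> // *; rewrite ?pe ?de. Qed.

Lemma alpha_equiv_beheadl (I : Type) (J : set I) (eta nu : I -> seq bool) c :
  alpha_equiv J eta nu -> (forall j, J j -> prefix [:: c] (eta j)) ->
  alpha_equiv J (behead \o eta) nu.
Proof.
move=> [me mn pe de] Jc.
have Ec j : J j -> eta j = c :: behead (eta j).
  by move=> /Jc; case: (eta j) => //= a s /andP[/eqP<-].
split=> // [|i j Ji Jj|i j d Ji Jj].
- by apply: (meet_closed_behead (c := c)) me _ _ => // j Jj; split=> // _; apply: Jc.
- by rewrite -pe // (Ec i) // (Ec j) //= eqxx.
- by rewrite -de // (Ec i) // (Ec j) //= eqxx.
Qed.

(** Two entries with different first letters would have the root as their meet. *)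
Lemma rootless_prefix (I : Type) (J : set I) (eta : I -> seq bool) :
  meet_closed J eta -> J !=set0 -> (forall j, J j -> eta j <> [::]) ->
  exists c, forall j, J j -> prefix [:: c] (eta j).
Proof.
move=> mc [i Ji] nr; case Ei: (eta i) => [|c s]; first by case: (nr _ Ji).
exists c => j Jj; case Ej: (eta j) => [|d t]; first by case: (nr _ Jj).
have [l Jl] := mc _ _ Ji Jj; rewrite Ei Ej /= prefix0s andbT.
by case: ifP => // _ /(nr _ Jl).
Qed.

Section TreeLimit.
Variable U : bool -> set_system (seq bool).
Hypothesis U_ultra : forall b, UltraFilter (U b).
Hypothesis U_absorb : forall b c A,
  U b [set s | U c [set t | A (s ++ c :: t)]] <-> U b A.

(* The iterated limit along [U] of the embeddings of the nodes of length less
   than [n] above [rcons s d], taken in depth-first order; deeper nodes get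
   junk values. *)
Fixpoint tree_lim n d s : set_system (seq bool -> seq bool) :=
  match n with
  | 0 => fun k => k (fun=> s)
  | n'.+1 => fun k => U d (fun w => let x := s ++ d :: w in
      tree_lim n' false x (fun f0 => tree_lim n' true x (fun f1 =>
        k (graft x f0 f1))))
  end.

Lemma tree_lim_ultra n d s : UltraFilter (tree_lim n d s).
Proof.
elim: n d s => [|n IH] d s /=.
  have := principal_filter_ultra (fun _ : seq bool => s).
  congr UltraFilter; apply/funext => A.
  by apply/propext; apply: principal_filterP.
apply: ultra_bind => x; set y := s ++ d :: x.
exact: ultra_bind (IH _ _) (fun f0 => ultra_preimage (graft y f0) (IH _ _)).
Qed.

Lemma tree_lim_const n d s (P : Prop) : tree_lim n d s (fun=> P) = P.
Proof. apply/propext; exact: ultra_const (tree_lim_ultra n d s). Qed.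

(** The root and the side opposite to [c] are not read by [k]. A limit along [U d] followed by one
    along [U c] remains, and [U_absorb] contracts it to one along [U d]; [0 < n] ensures that the
    second limit is there. *)
Lemma tree_lim_rootless (I : Type) (J : set I) (eta : I -> seq bool) k n d s c :
  local_on J k -> 0 < n -> (forall j, J j -> prefix [:: c] (eta j)) ->
  tree_lim n.+1 d s (fun f => k (f \o eta)) =
  tree_lim n d s (fun f => k (f \o (behead \o eta))).
Proof.
move=> kJ n0 Jc; set K := fun f => k (f \o (behead \o eta)).
transitivity (U d (fun w => tree_lim n c (s ++ d :: w) K)).
  congr (U d _); apply/funext => w; set x := s ++ d :: w.
  have kE f0 f1 : k (graft x f0 f1 \o eta) = K (if c then f1 else f0).
    apply: kJ => j /Jc /=; case: (eta j) => //= a t /andP[/eqP<- _].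
    by case: (c).
  rewrite /= -/x.
  transitivity (tree_lim n false x (fun f0 => tree_lim n true x (fun f1 =>
    K (if c then f1 else f0)))).
    congr (tree_lim n false x _); apply/funext => f0.
    by congr (tree_lim n true x _); apply/funext => f1.
  case: (c); first by rewrite tree_lim_const.
  by congr (tree_lim n false x _); apply/funext => f0; rewrite tree_lim_const.
case: n n0 => // n _ /=.
rewrite [RHS](propext (iff_sym (U_absorb d c _))) /=.
congr (U d _); apply/funext => w; congr (U c _); apply/funext => t.
by rewrite -catA.
Qed.

Lemma tree_lim_empty (I : Type) (J : set I) (eta nu : I -> seq bool) k n n' d s :
  local_on J k -> ~ (J !=set0) ->
  tree_lim n d s (fun f => k (f \o eta)) = tree_lim n' d s (fun f => k (f \o nu)).
Proof.
move=> kJ J0.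
have kE f : k f = k eta by apply: kJ => j Jj; case: J0; exists j.
transitivity (k eta).
  by rewrite -[RHS](tree_lim_const n d s); congr tree_lim; apply/funext => f.
by rewrite -[LHS](tree_lim_const n' d s); congr tree_lim; apply/funext => f.
Qed.

(** Induction on a bound for [n + n']. The two depths are separate because a missing root is skipped
    on one side at a time. The size bounds keep junk values out of reach. *)
Lemma tree_lim_alpha (I : Type) N n n' (J : set I) eta nu k d s :
  n + n' <= N -> (forall j, J j -> size (eta j) < n) ->
  (forall j, J j -> size (nu j) < n') -> alpha_equiv J eta nu -> local_on J k ->
  tree_lim n d s (fun f => k (f \o eta)) = tree_lim n' d s (fun f => k (f \o nu)).
Proof.
elim: N n n' J eta nu k d s => [|N IH] n n' J eta nu k d s leN ltn ltn' ae kJ;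
  have [[j0 Jj0]|J0] := pselect (J !=set0); last 1 first.
- exact: tree_lim_empty kJ J0.
- have := ltn _ Jj0; move: leN.
  by rewrite leqn0 addn_eq0 => /andP[/eqP-> _].
- exact: tree_lim_empty kJ J0.
have [me mn pe de] := ae.
have [[r Jr Er]|nr] := pselect (exists2 r, J r & eta r = [::]); last first.
  have [||c Jc] := rootless_prefix me; first by exists j0.
    by move=> j Jj Ej; apply: nr; exists j.
  have lb j : J j -> size (behead (eta j)) < n.-1.
    by move=> Jj; have := ltn _ Jj; have := Jc _ Jj; case: (eta j) (n) => [|a t] [].
  case: n ltn leN lb => [/(_ _ Jj0)//|n] ltn leN lb.
  rewrite (tree_lim_rootless _ _ kJ _ Jc); last exact: leq_trans (lb _ Jj0).
  by apply: IH (alpha_equiv_beheadl ae Jc) kJ.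
have [[r' Jr' Er']|nr] := pselect (exists2 r, J r & nu r = [::]); last first.
  have [||c Jc] := rootless_prefix mn; first by exists j0.
    by move=> j Jj Ej; apply: nr; exists j.
  have lb j : J j -> size (behead (nu j)) < n'.-1.
    by move=> Jj; have := ltn' _ Jj; have := Jc _ Jj; case: (nu j) (n') => [|a t] [].
  case: n' ltn' leN lb => [/(_ _ Jj0)//|n'] ltn' leN lb.
  rewrite [RHS](tree_lim_rootless _ _ kJ _ Jc); last exact: leq_trans (lb _ Jj0).
  apply: IH (alpha_equiv_sym (alpha_equiv_beheadl (alpha_equiv_sym ae) Jc)) kJ => //.
  by move: leN; rewrite addnS.
have {r' Jr' Er'}Er' : nu r = [::].
  by apply/eqP; have := pe _ _ Jr Jr'; rewrite Er Er' prefix0s prefixs0 => <-.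
case: n ltn leN => [/(_ _ Jj0)//|n] ltn leN.
case: n' ltn' leN => [/(_ _ Jj0)//|n'] ltn' leN.
have {}leN : n + n' <= N by move: leN; rewrite addSn addnS ltnS => /ltnW.
pose K c := [set j | J j /\ prefix [:: c] (eta j)].
have KJ c : K c `<=` J by move=> j [].
have Ke c j : J j -> prefix [:: c] (eta j) <-> K c j.
  by move=> Jj; split=> [|[]].
have Kn c j : J j -> prefix [:: c] (nu j) <-> K c j.
  by move=> Jj; rewrite -Ke // -[[:: c]]/(rcons [::] c) -{1}Er' -Er de.
have ltK c j : K c j -> size (behead (eta j)) < n.
  by move=> [/ltn]; case: (eta j).
have ltK' c j : K c j -> size (behead (nu j)) < n'.
  by move=> Kj; have Jj := KJ _ _ Kj; have := (Kn c j Jj).2 Kj; have := ltn' _ Jj; case: (nu j).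
have aeK c : alpha_equiv (K c) (behead \o eta) (behead \o nu).
  exact: alpha_equiv_behead ae (@KJ c) (Ke c) (Kn c).
(* The side of an entry is read off [nu]; on [J] it is also that of [eta], so one [merge] serves
   both tuples. *)
pose merge x (g0 g1 : I -> seq bool) j :=
  if nu j is c :: _ then (if c then g1 j else g0 j) else x.
have graft_nu x f0 f1 :
  k (graft x f0 f1 \o nu) = k (merge x (f0 \o (behead \o nu)) (f1 \o (behead \o nu))).
  by congr k; apply/funext => j; rewrite /merge /=; case: (nu j) => [|[] t].
have graft_eta x f0 f1 :
  k (graft x f0 f1 \o eta) = k (merge x (f0 \o (behead \o eta)) (f1 \o (behead \o eta))).
  apply: kJ => j Jj; rewrite /merge /=.
  have E c : prefix [:: c] (nu j) = prefix [:: c] (eta j).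
    by rewrite -[[:: c]]/(rcons [::] c) -{1}Er' -Er de.
  have := E true; have := E false.
  by case: (nu j) => [|[] t]; case: (eta j) => [|[] t'] //=; rewrite !prefix0s.
rewrite /=; congr (U d _); apply/funext => w; set x := s ++ d :: w.
(* Pass from [eta] to [nu] first in the inner limit, with [f0] fixed, then in the outer one. *)
transitivity (tree_lim n false x (fun f0 => tree_lim n' true x (fun f1 =>
    k (merge x (f0 \o (behead \o eta)) (f1 \o (behead \o nu)))))).
  congr (tree_lim n false x _); apply/funext => f0.
  under eq_fun do rewrite graft_eta.
  apply: (IH _ _ (K true) _ _ (fun g => k (merge x (f0 \o (behead \o eta)) g))) => //.
  - exact: ltK.
  - exact: ltK'.
  - move=> f g fg; apply: kJ => j Jj; rewrite /merge.
    have := Kn true j Jj; case: (nu j) => [|[] t] //= [+ _].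
    by rewrite prefix0s => /(_ isT)/fg.
transitivity (tree_lim n' false x (fun f0 => tree_lim n' true x (fun f1 =>
    k (merge x (f0 \o (behead \o nu)) (f1 \o (behead \o nu)))))).
  apply: (IH _ _ (K false) _ _ (fun g => tree_lim n' true x (fun f1 =>
    k (merge x g (f1 \o (behead \o nu)))))) => //.
  - exact: ltK.
  - exact: ltK'.
  - move=> f g fg; congr (tree_lim n' true x _); apply/funext => f1.
    apply: kJ => j Jj; rewrite /merge.
    have := Kn false j Jj; case: (nu j) => [|[] t] //= [+ _].
    by rewrite prefix0s => /(_ isT)/fg.
congr (tree_lim n' false x _); apply/funext => f0.
by congr (tree_lim n' true x _); apply/funext => f1; rewrite graft_nu.
Qed.

(** The first clause carries the induction: at the root, images of nodes on side [b] have to extend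
    [rcons x b]. *)
Lemma tree_lim_embedding n d s :
  tree_lim n d s (fun f => (forall y, size y < n -> prefix (rcons s d) (f y)) /\
    (forall z b y, size y < n -> prefix (rcons z b) y ->
       prefix (rcons (f z) b) (f y))).
Proof.
have LU := tree_lim_ultra.
elim: n d s => [|n IH] d s /=; first by split.
apply: (@filterS _ (U d) _ setT) => [w _|]; last exact: filterT.
set x := s ++ d :: w.
have sx y : prefix x y -> prefix (rcons s d) y.
  by apply: prefix_trans; rewrite /x -cat_rcons prefix_prefix.
have xc c y : prefix (rcons x c) y -> prefix x y.
  by apply: prefix_trans; rewrite -cats1 prefix_prefix.
have := IH false x; apply: filterS => f0 [f0x f0e].
have := IH true x; apply: filterS => f1 [f1x f1e].
split=> [[|[] y] /= lty|].
- by apply: sx; rewrite prefix_refl.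
- exact/sx/xc/f1x.
- exact/sx/xc/f0x.
move=> [|[] z] b [|[] y] //=; rewrite ?prefix_cons //= => lty.
- by case: b => //= _; apply: f1x.
- by case: b => //= _; apply: f0x.
- exact: f1e.
- exact: f0e.
Qed.

End TreeLimit.

(** [W] extends the filter of sets that belong to [tree_lim] at all large depths, where a given
    finite tuple meets no junk values. *)
Lemma tree_ultrafilter : exists W : set_system (seq bool -> seq bool),
  [/\ UltraFilter W,
      forall z b y, prefix (rcons z b) y ->
        W (fun f => prefix (rcons (f z) b) (f y)) &
      forall (I : finType) (eta nu : I -> seq bool) (k : set (I -> seq bool)),
        alpha_equiv setT eta nu ->
        W (fun f => k (f \o eta)) <-> W (fun f => k (f \o nu))].
Proof.
have [U [UU Ua]] := branching_ultrafilters.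
have LU n := tree_lim_ultra UU n false [::].
pose F : set_system (seq bool -> seq bool) :=
  [set A | exists n0, forall n, n0 <= n -> tree_lim U n false [::] A].
have Fpf : ProperFilter F.
  split=> [[n0 /(_ _ (leqnn _))]|]; first exact: filter_not_empty.
  split=> [|A B [n An] [m Bm]|A B AB [n An]].
  - by exists 0 => n _; apply: filterT.
  - exists (maxn n m) => l; rewrite geq_max => /andP[nl ml].
    by apply: filterI; [apply: An|apply: Bm].
  - by exists n => l nl; apply: filterS AB (An _ nl).
have [W [WU FW]] := ultraFilterLemma Fpf.
exists W; split=> // [z b y zy|I eta nu k ae].
  apply: FW; exists (size y).+1 => n lty.
  by have := tree_lim_embedding UU n false [::]; apply: filterS => f [_]; apply.
suff WW (A B : set (seq bool -> seq bool)) n0 :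
  (forall n, n0 <= n -> tree_lim U n false [::] A = tree_lim U n false [::] B) ->
  W A -> W B.
  pose n0 := (\max_(i : I) maxn (size (eta i)) (size (nu i))).+1.
  have EE n : n0 <= n -> tree_lim U n false [::] (fun f => k (f \o eta)) =
                         tree_lim U n false [::] (fun f => k (f \o nu)).
    move=> n0n; apply: (@tree_lim_alpha U UU Ua I (n + n) n n setT) => // [j _|j _|f g fg].
    - apply: leq_trans n0n; rewrite ltnS.
      by apply: leq_trans (leq_bigmax j); apply: leq_maxl.
    - apply: leq_trans n0n; rewrite ltnS.
      by apply: leq_trans (leq_bigmax j); apply: leq_maxr.
    - by congr k; apply/funext => j; apply: fg.
  by split; apply: WW => n /EE.
move=> AB WA; have : W (fun f => A f -> B f).
  apply: FW; exists n0 => n /AB; have := LU n => LUn E.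
  have [|H] := in_ultra_setVsetC B LUn; first by apply: filterS.
  have := (ultra_setC A LUn).2; rewrite E => /(_ ((ultra_setC B LUn).1 H)).
  by apply: filterS => f.
by move: WA; apply: filterS2 => f ? ; apply.
Qed.

(** * Ultrapowers *)

Section Ultrapower.
Variables (L : language) (M : structure L) (I : Type) (W : set_system I).
Hypothesis W_ultra : UltraFilter W.

Definition ae_eq (F G : I -> M) : Prop := W (fun i => F i = G i).

Lemma ae_eq_class (F G : I -> M) : ae_eq F G <-> ae_eq F = ae_eq G.
Proof.
split=> [FG|->]; last by apply: (@filterS _ W _ setT) => //; apply: filterT.
apply/funext => H; apply/propext; split; rewrite /ae_eq.
  by apply: filterS2 FG => i ->.
by apply: filterS2 FG => i <-.
Qed.

(** Classes are sets of functions, so that equality almost everywhere becomes the equality by which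
    [sat] interprets [Eqf]. *)
Definition upow_dom : Type := {C : set (I -> M) | exists F, C = ae_eq F}.

Definition upow_class (F : I -> M) : upow_dom :=
  exist _ (ae_eq F) (ex_intro _ F erefl).

Definition upow_repr (c : upow_dom) : I -> M := projT1 (cid (proj2_sig c)).

Lemma upow_class_eq (F G : I -> M) : upow_class F = upow_class G <-> ae_eq F G.
Proof.
split=> [[/ae_eq_class]//|/ae_eq_class FG].
exact: eq_exist.
Qed.

Lemma upow_reprK : cancel upow_repr upow_class.
Proof.
move=> [C HC]; apply: eq_exist; rewrite /upow_repr /=.
by case: cid.
Qed.

Lemma upow_classK (F : I -> M) : W (fun i => upow_repr (upow_class F) i = F i).
Proof. by apply/upow_class_eq; rewrite upow_reprK. Qed.

Definition upow : structure L := @Structure L upow_dom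
  (upow_class (fun=> inhab M))
  (fun f args => upow_class (fun i => funI (fun k => upow_repr (args k) i)))
  (fun r args => W (fun i => relI (fun k => upow_repr (args k) i))).

Lemma eval_upow (V : Type) (F : V -> I -> M) (t : term L V) :
  eval (M := upow) (fun v => upow_class (F v)) t =
  upow_class (fun i => eval (fun v => F v i) t).
Proof.
elim: t => [//|f args IH] /=; apply/upow_class_eq.
have : W (fun i => forall k, upow_repr (upow_class
    (fun i => eval (fun v => F v i) (args k))) i = eval (fun v => F v i) (args k)).
  by apply: filter_forall => k; apply: upow_classK.
apply: filterS => i Ei; congr funI; apply/funext => k.
by rewrite IH Ei.
Qed.

(* Los's theorem. *)
Lemma sat_upow (V : Type) (phi : formula L V) (F : V -> I -> M) :
  sat upow phi (fun v => upow_class (F v)) <->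
  W (fun i => sat M phi (fun v => F v i)).
Proof.
elim: phi F => {V} [V|V t u|V r args|V p IH|V p IHp q IHq|V p IH] F /=.
- by split=> // /(@filter_not_empty _ W).
- by rewrite !eval_upow; apply: upow_class_eq.
- have : W (fun i => forall k, upow_repr (upow_class
      (fun i => eval (fun v => F v i) (args k))) i = eval (fun v => F v i) (args k)).
    by apply: filter_forall => k; apply: upow_classK.
  move=> WE; split; apply: filterS2 WE => i Ei; rewrite (_ : (fun k => _) =
    (fun k => eval (fun v => F v i) (args k))) //; apply/funext => k.
    by rewrite eval_upow Ei.
  by rewrite eval_upow Ei.
- rewrite IH; apply: iff_sym; exact: (ultra_setC (fun i => sat M p (fun v => F v i)) W_ultra).
- rewrite IHp IHq; split=> [[]|H]; first exact: filterI.
  by split; apply: filterS H => i [].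
- have extE (a : I -> M) : ext (fun v => upow_class (F v)) (upow_class a) =
      fun v => upow_class (fun i => ext (fun v => F v i) (a i) v).
    by apply/funext => -[].
  split=> [[a]|H].
    rewrite -(upow_reprK a) extE IH; apply: filterS => i sa.
    by exists (upow_repr a i).
  (* [inhab M] is the default at indices without a witness; by [H] these are negligible. *)
  have /choice[g Hg] : forall i, exists b : M,
      (exists a, sat M p (ext (fun v => F v i) a)) ->
      sat M p (ext (fun v => F v i) b).
    move=> i.
    have [[a Ha]|nE] := pselect (exists a, sat M p (ext (fun v => F v i) a)).
      by exists a.
    by exists (inhab M).
  exists (upow_class g); rewrite extE IH.
  by apply: filterS H => i; apply: Hg.
Qed.

Lemma upow_elem_equiv : elem_equiv M upow.
Proof.
move=> psi; have := sat_upow psi (fun v _ => match v : void return M with end).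
have -> : (fun v : void => upow_class (fun=> match v return M with end)) =
          (fun v => match v with end) by apply/funext; case.
by move=> ->; apply: iff_sym; apply: (ultra_const _ W_ultra).
Qed.

End Ultrapower.

(** * Beta-equivalence and alpha-equivalence *)

Lemma tmeet_prefix s t : prefix s t -> tmeet s t = s.
Proof.
elim: s t => [|b s IH] [|c t] //=.
by case/andP=> /eqP<- /IH->; rewrite eqxx.
Qed.

Lemma tmeetC s t : tmeet s t = tmeet t s.
Proof.
elim: s t => [|b s IH] [|c t] //=.
by rewrite eq_sym; case: eqP => // ->; rewrite IH.
Qed.

Lemma tmeet_cat r s t : tmeet (r ++ s) (r ++ t) = r ++ tmeet s t.
Proof. by elim: r => //= b r ->; rewrite eqxx. Qed.

Lemma tmeet_diverge r s t b :
  prefix (rcons r b) s -> prefix (rcons r (~~ b)) t -> tmeet s t = r.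
Proof.
move=> /prefixP[x ->] /prefixP[y ->]; rewrite !cat_rcons tmeet_cat /=.
by case: b; rewrite cats0.
Qed.

Lemma prefix_trichotomy (s t : seq bool) : [\/ prefix s t, prefix t s |
  exists r b, prefix (rcons r b) s /\ prefix (rcons r (~~ b)) t].
Proof.
elim: s t => [|b s IH] [|c t]; try by [constructor 1|constructor 2].
case: (eqVneq b c) => [<-|bc]; last first.
  by constructor 3; exists [::], b; case: b c bc => [] [] //= _; rewrite !prefix0s.
case: (IH t) => [st|ts|[r [d [rs rt]]]].
- by constructor 1; rewrite /= eqxx.
- by constructor 2; rewrite /= eqxx.
- by constructor 3; exists (b :: r), d; rewrite /= eqxx.
Qed.

Lemma prefix_antisym (s t : seq bool) : (s == t) = prefix s t && prefix t s.
Proof.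
apply/eqP/andP => [->|[st ts]]; first by rewrite prefix_refl.
by rewrite -(tmeet_prefix st) tmeetC tmeet_prefix.
Qed.

Lemma prefix_rconsr (s t : seq bool) b :
  prefix s (rcons t b) = prefix s t || (s == rcons t b).
Proof.
elim: s t => [|c s IH] [|d t] //=.
by rewrite eqseq_cons IH andb_orr.
Qed.

(* [spread] puts [rcons r true] below all of [rcons r false ++ t], so that being
   an immediate right successor becomes visible to [prefix] and [tmeet]. *)
Fixpoint spread (s : seq bool) : seq bool :=
  if s is b :: s' then true :: (if b then spread s' else false :: spread s')
  else [::].

Lemma spread_cat s t : spread (s ++ t) = spread s ++ spread t.
Proof. by elim: s => //= -[] s ->. Qed.

Lemma spread_rcons1 s : spread (rcons s true) = rcons (spread s) true.
Proof. by rewrite -cats1 spread_cat cats1. Qed.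

(** Both code words [1] and [10] begin with [true], so in the image every proper extension turns
    right. *)
Lemma prefix_spread1 s t :
  prefix (rcons (spread s) true) (spread t) = prefix s t && ~~ prefix t s.
Proof.
elim: s t => [|[] s IH] [|[] t] //=; rewrite ?prefix0s //.
by case: s {IH}.
by case: (t).
Qed.

(** No code word begins with [false], so a left turn after [spread s] happens inside a code word
    [10] of [t] whose [1] is the code of the last letter of [s]. *)
Lemma prefix_spread0P s t :
  reflect (exists2 r, s = rcons r true & prefix (rcons r false) t)
    (prefix (rcons (spread s) false) (spread t)).
Proof.
apply: (iffP idP) => [|[r -> /prefixP[x ->]]]; last first.
  rewrite cat_rcons spread_cat spread_rcons1 -2!cats1 -catA /=.
  by apply/prefixP; exists (spread x); rewrite -catA.
elim: s t => [|[] s IH] [|[] t] //=.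
- by case/IH=> r -> rt; exists (true :: r).
- by case: s {IH} => [_|[] s] //; exists [::]; rewrite //= prefix0s.
- by case: t.
- by case/IH=> r -> rt; exists (false :: r).
Qed.

Lemma prefix_spread s t : prefix (spread s) (spread t) =
  prefix s t || prefix (rcons (spread s) false) (spread t).
Proof.
elim: s t => [|[] s IH] [|[] t] //=.
  by case: s {IH} => [|[] s] //=; rewrite ?prefix0s.
by case: t.
Qed.

(** The images of [rcons r true] and [rcons r false] have meet [spread (rcons r true)]. Adding right
    successors makes the image of a meet-closed tuple meet-closed. *)
Definition with_succ (I : Type) (eta : I -> seq bool) (p : I * bool) :=
  if p.2 then rcons (eta p.1) true else eta p.1.

Section BetaToAlpha.
Variables (n : nat) (eta : 'I_n -> seq bool).
Hypothesis eta_meet : forall i j, exists l, eta l = tmeet (eta i) (eta j).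

Lemma prefix_with_succ p q : prefix (with_succ eta p) (with_succ eta q) =
  match p.2, q.2 with
  | false, false => prefix (eta p.1) (eta q.1)
  | false, true => prefix (eta p.1) (eta q.1) || (rcons (eta q.1) true == eta p.1)
  | true, false => prefix (rcons (eta p.1) true) (eta q.1)
  | true, true => prefix (rcons (eta p.1) true) (eta q.1) ||
      prefix (eta p.1) (eta q.1) && prefix (eta q.1) (eta p.1)
  end.
Proof.
case: p q => [i []] [j []]; rewrite /with_succ //= prefix_rconsr.
  by rewrite eqseq_rcons eqxx andbT -prefix_antisym.
by rewrite eq_sym.
Qed.

Lemma prefix_rcons0_with_succ r q :
  prefix (rcons r false) (with_succ eta q) = prefix (rcons r false) (eta q.1).
Proof.
case: q => [j []]; rewrite /with_succ //= prefix_rconsr.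
by rewrite eqseq_rcons andbF orbF.
Qed.

(** A node [r] with [rcons r true = eta p.1] at which [eta q.1] turns left is the meet of the two,
    hence an entry; so [approx_beta] decides the relation. *)
Lemma with_succ_spread0 p q :
  prefix (rcons (spread (with_succ eta p)) false) (spread (with_succ eta q)) <->
  if p.2 then is_true (prefix (rcons (eta p.1) false) (eta q.1))
  else exists2 l, rcons (eta l) true == eta p.1 &
         prefix (rcons (eta l) false) (eta q.1).
Proof.
split=> [/prefix_spread0P[r]|].
  rewrite prefix_rcons0_with_succ; case: p => [i []] /=; rewrite /with_succ /=.
    by move=> /rcons_inj[->].
  move=> Ei rq; have [l El] := eta_meet i q.1; exists l.
    by rewrite El Ei (tmeet_diverge (b := true) (prefix_refl _) rq).
  by rewrite El Ei (tmeet_diverge (b := true) (prefix_refl _) rq).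
move=> H; apply/prefix_spread0P.
case: p H => [i []] /= => [iq|[l /eqP El lq]].
  by exists (eta i) => //; rewrite prefix_rcons0_with_succ.
by exists (eta l) => //; rewrite prefix_rcons0_with_succ.
Qed.

Lemma with_succ_diverge p q r :
  prefix (rcons r true) (with_succ eta p) ->
  prefix (rcons r false) (with_succ eta q) -> exists l, eta l = r.
Proof.
rewrite prefix_rcons0_with_succ => rp rq.
have [rp'|] := boolP (prefix (rcons r true) (eta p.1)).
  by have [l El] := eta_meet p.1 q.1; exists l; rewrite El (tmeet_diverge rp' rq).
case: p rp => [i []] /=; rewrite /with_succ /=; last by move->.
by rewrite prefix_rconsr => /orP[->//|/eqP/rcons_inj[-> _]]; exists i.
Qed.

Lemma with_succ_meet_closed : meet_closed setT (spread \o with_succ eta).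
Proof.
move=> p q _ _.
suff div p' q' r : prefix (rcons r true) (with_succ eta p') ->
    prefix (rcons r false) (with_succ eta q') ->
    exists2 l, setT l & (spread \o with_succ eta) l =
      tmeet (spread (with_succ eta p')) (spread (with_succ eta q')).
  case: (prefix_trichotomy (with_succ eta p) (with_succ eta q)) => [pq|qp|].
  - by exists p => //=; rewrite tmeet_prefix // prefix_spread pq.
  - by exists q => //=; rewrite tmeetC tmeet_prefix // prefix_spread qp.
  - move=> [r [[] /= [rp rq]]]; first exact: div rp rq.
    by rewrite /= tmeetC; apply: div rq rp.
move=> rp rq; have [l El] := with_succ_diverge rp rq.
(* The nodes part at [r], but their images part one letter later, at [spread (rcons r true)]. *)
exists (l, true) => //; move/prefixP: rp => [x ->]; move/prefixP: rq => [y ->].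
rewrite /= /with_succ /= El !cat_rcons !spread_cat spread_rcons1 tmeet_cat /=.
have -> : tmeet (spread x) (false :: spread y) = [::] by case: (x) => [|[] x'].
by rewrite cats1.
Qed.

End BetaToAlpha.

Lemma approx_beta_alpha n (eta nu : 'I_n -> seq bool) : approx_beta eta nu ->
  alpha_equiv setT (spread \o with_succ eta) (spread \o with_succ nu).
Proof.
move=> [me [mn [pe [de se]]]].
have pE p q : prefix (with_succ eta p) (with_succ eta q) =
              prefix (with_succ nu p) (with_succ nu q).
  by rewrite !prefix_with_succ !pe !de !se.
have sE p q :
    prefix (rcons (spread (with_succ eta p)) false) (spread (with_succ eta q)) =
    prefix (rcons (spread (with_succ nu p)) false) (spread (with_succ nu q)).
  apply/idP/idP => /with_succ_spread0 H; apply/with_succ_spread0 => //.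
    by move: H => /(_ me); rewrite de; case: p.2 => // -[l]; exists l; rewrite -?se -?de.
  by move: H => /(_ mn); rewrite de; case: p.2 => // -[l]; exists l; rewrite ?se ?de.
split.
- exact: with_succ_meet_closed.
- exact: with_succ_meet_closed.
- by move=> p q _ _; rewrite /= !prefix_spread pE sE.
- by move=> p q [] _ _ /=; rewrite ?sE // !prefix_spread1 !pE.
Qed.

(** * The indiscernible tree in the ultrapower *)

Lemma mem_In (T : eqType) (x : T) (s : seq T) : x \in s -> List.In x s.
Proof.
by elim: s => //= y s IH; rewrite inE => /orP[/eqP->|/IH]; [left|right].
Qed.

Theorem theorem3p8 (L : language) (M : structure L) (k m : nat)
  (phi : formula L ('I_k + 'I_m)) :
  (exists a : seq bool -> 'I_m -> M, witnesses_SOP1 M phi a) ->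
  exists (N : structure L) (e : seq bool -> 'I_m -> N),
    elem_equiv M N /\ beta_indiscernible N e /\ witnesses_SOP1 N phi e.
Proof.
move=> [a [a_cons a_incons]].
have [W [WU Wemb Walpha]] := tree_ultrafilter.
pose d (f : seq bool -> seq bool) s := a (rcons (f (spread s)) true).
pose e s c : upow M W := upow_class W (fun f => d f s c).
exists (upow M W), e; split; first exact: upow_elem_equiv.
have joinE (x : (seq bool -> seq bool) -> 'I_k -> M) s :
    join (fun c => upow_class W (fun f => x f c) : upow M W) (e s) =
    fun v => upow_class W (fun f => join (x f) (d f s) v).
  by apply/funext => -[].
split=> [n eta nu /approx_beta_alpha ae psi|].
  (* [K] reads the original nodes; the added successors serve to close the images under meets. *)
  pose K (g : 'I_n.+1 * bool -> seq bool) :=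
    sat M psi (fun p => a (rcons (g (p.1, false)) true) p.2).
  have := Walpha _ _ _ K ae.
  by rewrite /K /= /with_succ /= -!(sat_upow WU).
split=> [eta s sA|eta nu consN].
  have [N HN] : exists N, forall b, List.In b s ->
      exists2 n, n < N & b = e (restr eta n).
    elim: s sA => [|b s IH] sA; first by exists 0.
    have [|N HN] := IH; first by move=> b' Hb'; apply: sA; right.
    have [|n En] := sA b; first by left.
    exists (maxn n.+1 N) => b' [<-|/HN[n' ltn' En']].
      by exists n => //; rewrite leq_max leqnn.
    by exists n' => //; rewrite leq_max ltn' orbT.
  have Wchain : W (fun f => forall j : 'I_N,
      prefix (rcons (f (spread (restr eta j))) true) (f (spread (restr eta j.+1)))).
    apply: filter_forall => j; apply: Wemb; rewrite prefix_spread1.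
    rewrite /restr mkseqS prefix_rcons /=.
    apply/negP => /size_prefix; rewrite size_rcons; by rewrite ltnn.
  (* A realization in [M] for each [f] that maps the initial segments to a chain turning right, a
     default for the others; its class realizes the finite type in the ultrapower. *)
  have /choice[x Hx] : forall f, exists x : 'I_k -> M,
      (forall j : 'I_N, prefix (rcons (f (spread (restr eta j))) true)
                          (f (spread (restr eta j.+1)))) ->
      forall j : 'I_N, sat M phi (join x (d f (restr eta j))).
    move=> f; have [Hf|nHf] := pselect (forall j : 'I_N, prefix
      (rcons (f (spread (restr eta j))) true) (f (spread (restr eta j.+1)))); last first.
      by exists (fun=> inhab M) => /nHf.
    pose y j := rcons (f (spread (restr eta j))) true.
    have yN j : j <= N -> prefix (y j) (y N).
      move=> jN; suff y_le i : j + i <= N -> prefix (y j) (y (j + i)).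
        by have := y_le (N - j); rewrite subnKC //; apply.
      elim: i => [|i IH] ijN; first by rewrite addn0 prefix_refl.
      rewrite addnS in ijN *; apply: prefix_trans (IH (ltnW ijN)) _.
      exact: prefix_trans (Hf (Ordinal ijN)) (prefix_rcons _ _).
    (* Prolonged by [false] beyond [y N], the chain lies on a single infinite branch, to which
       [a_cons] applies. *)
    have yE j : j <= N -> y j = restr (nth false (y N)) (size (y j)).
      move=> /yN/prefixP[z ->]; apply: (@eq_from_nth _ false); first by rewrite size_mkseq.
      by move=> i ltj; rewrite nth_mkseq // nth_cat ltj.
    have [|x Hx] := a_cons (nth false (y N)) [seq a (y (val j)) | j <- enum 'I_N].
      move=> b /List.in_map_iff[j [<- _]]; exists (size (y j)).
      by rewrite -yE // ltnW.
    exists x => _ j; apply: Hx; apply/List.in_map_iff; exists j; split=> //.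
    by apply: mem_In; rewrite mem_enum.
  exists (fun c => upow_class W (fun f => x f c)) => b /HN[n ltn ->].
  rewrite joinE sat_upow; apply: filterS Wchain => f /Hx /(_ (Ordinal ltn)).
  exact.
have [|X HX] := consN [:: e (rcons eta true); e (rcons eta false ++ nu)].
  by move=> b [<-|[<-|[]]]; [left|right].
have X_E : X = fun c => upow_class W (fun f => upow_repr (X c) f).
  by apply/funext => c; rewrite upow_reprK.
have := HX _ (or_introl erefl); have := HX _ (or_intror (or_introl erefl)).
rewrite X_E !joinE !sat_upow => H0 H1.
have : W (fun f => prefix (rcons (f (spread (rcons eta true))) false)
                     (f (spread (rcons eta false ++ nu)))).
  by apply: Wemb; apply/prefix_spread0P; exists eta; rewrite ?prefix_prefix.
move=> H2; have [f [[H0f H1f] H2f]] := filter_ex (filterI (filterI H0 H1) H2).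
move: H2f => /prefixP[z Ez].
(* With [r] the image of the first node, the parameters are [a] at [rcons r true] and at
   [rcons r false ++ rcons z true]. *)
apply: (a_incons (f (spread (rcons eta true))) (rcons z true)) => s sA.
exists (fun c => upow_repr (X c) f) => b /sA [->|->]; first exact: H1f.
by move: H0f; rewrite /d Ez rcons_cat.
Qed.
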